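(* For every epistemic program $\Pi$ (a set of rules as defined in the context), every equilibrium world view of $\Pi$ is founded with respect to $\Pi$. (That is, Founded Autoepistemic Equilibrium Logic satisfies foundedness.)
   Context: Fix a set $\mathrm{At}$ of atoms. Formulas: $\varphi ::= \bot \mid a \mid \varphi_1\wedge\varphi_2 \mid \varphi_1\vee\varphi_2\mid \varphi_1\to\varphi_2 \mid \mathbf{L}\varphi$; $\neg\varphi := \varphi\to\bot$, $\top:=\neg\bot$, $\varphi\leftarrow\psi := \psi\to\varphi$. A propositional interpretation is $I\subseteq\mathrm{At}$; a belief view $\mathcal W$ is a set of them. Classical modal satisfaction $\langle\mathcal W,I\rangle\models\varphi$: classical for $\bot,\wedge,\vee,\to$, $\langle\mathcal W,I\rangle\models a$ iff $a\in I$, and $\langle\mathcal W,I\rangle\models\mathbf L\psi$ iff $\langle\mathcal W,J\rangle\models\psi$ for all $J\in\mathcal W$. Programs. An objective literal is $a$, $\neg a$ or $\neg\neg a$; a subjective literal is $\mathbf L l$, $\neg\mathbf L l$, $\neg\neg\mathbf L l$ with $l$ objective; a literal is positive if it contains no negation. A rule $r$ is $a_1\vee\dots\vee a_n\leftarrow B_1\wedge\dots\wedge B_m$ ($n,m\ge 0$, $n+m>0$, $a_i$ atoms, $B_j$ literals), $\mathrm{Head}(r)=\{a_1,\dots,a_n\}$, $\mathrm{Body}(r)=B_1\wedge\dots\wedge B_m$; $\mathrm{Body}^+_{ob}(r)=\{a : a \text{ is some } B_j\}$, $\mathrm{Body}^+_{sub}(r)=\{a : \mathbf L a \text{ is some }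 B_j\}$. A program is a set of rules. Unfounded set w.r.t. $\Pi$ and $\mathcal W$: a non-empty set $\mathcal U$ of pairs $\langle X,I\rangle$ of sets of atoms such that, with $Y=\bigcup\{X':\langle X',I'\rangle\in\mathcal U\}$, for each $\langle X,I\rangle\in\mathcal U$ no rule $r\in\Pi$ with $\mathrm{Head}(r)\cap X\ne\emptyset$ satisfies all of: (1) $\langle\mathcal W,I\rangle\models\mathrm{Body}(r)$; (2) $\mathrm{Body}^+_{ob}(r)\cap X=\emptyset$; (3) $(\mathrm{Head}(r)\setminus X)\cap I=\emptyset$; (4) $\mathrm{Body}^+_{sub}(r)\cap Y=\emptyset$. $\mathcal W$ is unfounded if some unfounded set $\mathcal U$ has $I\in\mathcal W$ and $X\cap I\ne\emptyset$ for all $\langle X,I\rangle\in\mathcal U$; founded otherwise. FAEEL. HT belief views are non-empty sets $\mathcal W$ of pairs $\langle H_i,T_i\rangle$, $H_i\subseteq T_i\subseteq\mathrm{At}$; $\mathcal W^t=\{T_i\}$; total if all $H_i=T_i$. For $\mathcal I=\langle\mathcal W,H,T\rangle$ with $H\subseteq T$: $\mathcal I\not\models\bot$; $\mathcal I\models a$ iff $a\in H$; $\wedge,\vee$ componentwise; $\mathcal I\models\psi_1\to\psi_2$ iff ($\mathcal I\not\models\psi_1$ or $\mathcal I\models\psi_2$) and ($\langle\mathcal W^t,T,T\rangle\not\models\psi_1$ or $\langle\mathcal W^t,T,T\rangle\models\psi_2$); $\mathcal I\models\mathbf L\psi$ iff $\langle\mathcal W,H_i,T_i\rangle\models\psi$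 for all $\langle H_i,T_i\rangle\in\mathcal W$. Belief model of $\Gamma$: $\langle\mathcal W,H_i,T_i\rangle\models\varphi$ for all $\varphi\in\Gamma$ and all $\langle H_i,T_i\rangle\in\mathcal W\cup\{\langle H,T\rangle\}$. $\langle\mathcal W',H',T'\rangle\preceq\langle\mathcal W,H,T\rangle$ iff $T'=T$, $H'\subseteq H$, every $\langle H_i,T_i\rangle\in\mathcal W$ has some $\langle H'_i,T_i\rangle\in\mathcal W'$ with $H'_i\subseteq H_i$, and every $\langle H'_i,T_i\rangle\in\mathcal W'$ has some $\langle H_i,T_i\rangle\in\mathcal W$ with $H'_i\subseteq H_i$. A total $\langle\mathcal W,T,T\rangle$ is an equilibrium belief model of $\Gamma$ if it is a belief model and no belief model is strictly $\prec$ below it; $\mathrm{EQB}[\Gamma]$ is their set. A (total) belief view $\mathcal W$ is an equilibrium world view of $\Gamma$ iff $\mathcal W=\{T:\langle\mathcal W,T,T\rangle\in\mathrm{EQB}[\Gamma]\}$. *)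

(* Defs.v *)
From mathcomp Require Import all_boot.
From mathcomp Require Import boolp classical_sets.
From Stdlib Require List.

Set Implicit Arguments.
Unset Strict Implicit.
Unset Printing Implicit Defensive.

Local Open Scope classical_set_scope.

Inductive formula (At : Type) : Type :=
| Bot
| Atom of At
| And of formula At & formula At
| Or of formula At & formula At
| Imp of formula At & formula At
| Lop of formula At.

Arguments Bot {At}.

Definition Neg (At : Type) (f : formula At) : formula At := Imp f Bot.
Definition Top {At : Type} : formula At := Neg Bot.

Fixpoint sat (At : Type) (W : set (set At)) (I : set At) (f : formula At)
    {struct f} : Prop :=
  match f with
  | Bot => False
  | Atom a => I a
  | And f1 f2 => sat W I f1 /\ sat W I f2
  | Or f1 f2 => sat W I f1 \/ sat W I f2
  | Imp f1 f2 => sat W I f1 -> sat W I f2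
  | Lop f1 => forall J, W J -> sat W J f1
  end.

Inductive obj_literal (At : Type) : Type :=
| OPos of At      (* a *)
| ONeg of At      (* ~ a *)
| ONegNeg of At.  (* ~ ~ a *)

Inductive literal (At : Type) : Type :=
| LObj of obj_literal At          (* l *)
| LSub of obj_literal At          (* L l *)
| LNegSub of obj_literal At       (* ~ L l *)
| LNegNegSub of obj_literal At.   (* ~ ~ L l *)

Definition obj_formula (At : Type) (l : obj_literal At) : formula At :=
  match l with
  | OPos a => Atom a
  | ONeg a => Neg (Atom a)
  | ONegNeg a => Neg (Neg (Atom a))
  end.

Definition lit_formula (At : Type) (l : literal At) : formula At :=
  match l with
  | LObj o => obj_formula o
  | LSub o => Lop (obj_formula o)
  | LNegSub o => Neg (Lop (obj_formula o))
  | LNegNegSub o => Neg (Neg (Lop (obj_formula o)))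
  end.

Record rule (At : Type) : Type := Rule {
  head_atoms : seq At;
  body_lits : seq (literal At);
  rule_nonempty : (0 < size head_atoms + size body_lits)%N
}.

(* The empty disjunction is Bot and the empty conjunction is Top. *)
Definition head_formula (At : Type) (r : rule At) : formula At :=
  foldr (fun a f => Or (Atom a) f) Bot (head_atoms r).

Definition body_formula (At : Type) (r : rule At) : formula At :=
  foldr (fun l f => And (lit_formula l) f) Top (body_lits r).

Definition rule_formula (At : Type) (r : rule At) : formula At :=
  Imp (body_formula r) (head_formula r).

Definition program_theory (At : Type) (Pi : set (rule At)) : set (formula At) :=
  [set rule_formula r | r in Pi].

Definition Head (At : Type) (r : rule At) : set At :=
  [set a | List.In a (head_atoms r)].

Definition Body_pos_ob (At : Type) (r : rule At) : set At :=
  [set a | List.In (LObj (OPos a)) (body_lits r)].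

Definition Body_pos_sub (At : Type) (r : rule At) : set At :=
  [set a | List.In (LSub (OPos a)) (body_lits r)].

Definition unfounded_set (At : Type) (Pi : set (rule At)) (W : set (set At))
    (U : set (set At * set At)) : Prop :=
  let Y := \bigcup_(p in U) p.1 in
  U !=set0 /\
  forall X I, U (X, I) ->
    ~ exists r, [/\ Pi r, Head r `&` X !=set0 &
        [/\ sat W I (body_formula r),
            Body_pos_ob r `&` X = set0,
            (Head r `\` X) `&` I = set0 &
            Body_pos_sub r `&` Y = set0]].

Definition unfounded (At : Type) (Pi : set (rule At)) (W : set (set At)) : Prop :=
  exists U, unfounded_set Pi W U /\
    forall X I, U (X, I) -> W I /\ X `&` I !=set0.

Definition founded (At : Type) (Pi : set (rule At)) (W : set (set At)) : Prop :=
  ~ unfounded Pi W.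

(* The side conditions (non-empty view, H included in T) are imposed by
   is_ht_interp below. *)
Record ht_interp (At : Type) : Type := HT {
  view : set (set At * set At);
  here : set At;
  there : set At
}.

Definition is_ht_view (At : Type) (W : set (set At * set At)) : Prop :=
  W !=set0 /\ forall H T, W (H, T) -> H `<=` T.

Definition is_ht_interp (At : Type) (I : ht_interp At) : Prop :=
  is_ht_view (view I) /\ here I `<=` there I.

Definition there_view (At : Type) (W : set (set At * set At)) : set (set At) :=
  [set p.2 | p in W].

(* A set of interpretations, seen as a total HT belief view. *)
Definition total_view (At : Type) (W : set (set At)) : set (set At * set At) :=
  [set (T, T) | T in W].

Definition is_total (At : Type) (I : ht_interp At) : Prop :=
  (forall H T, view I (H, T) -> H = T) /\ here I = there I.

Fixpoint ht_sat (At : Type) (W : set (set At * set At)) (H T : set At)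
    (f : formula At) {struct f} : Prop :=
  match f with
  | Bot => False
  | Atom a => H a
  | And f1 f2 => ht_sat W H T f1 /\ ht_sat W H T f2
  | Or f1 f2 => ht_sat W H T f1 \/ ht_sat W H T f2
  | Imp f1 f2 =>
      (ht_sat W H T f1 -> ht_sat W H T f2) /\
      (ht_sat (total_view (there_view W)) T T f1 ->
       ht_sat (total_view (there_view W)) T T f2)
  | Lop f1 => forall Hi Ti, W (Hi, Ti) -> ht_sat W Hi Ti f1
  end.

Definition belief_model (At : Type) (G : set (formula At)) (I : ht_interp At) :
    Prop :=
  is_ht_interp I /\
  forall f, G f -> forall Hi Ti,
    (view I `|` [set (here I, there I)]) (Hi, Ti) -> ht_sat (view I) Hi Ti f.

Definition ht_le (At : Type) (I' I : ht_interp At) : Prop :=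
  [/\ there I' = there I,
      here I' `<=` here I,
      forall Hi Ti, view I (Hi, Ti) ->
        exists Hi', view I' (Hi', Ti) /\ Hi' `<=` Hi &
      forall Hi' Ti, view I' (Hi', Ti) ->
        exists Hi, view I (Hi, Ti) /\ Hi' `<=` Hi].

Definition ht_lt (At : Type) (I' I : ht_interp At) : Prop :=
  ht_le I' I /\ I' <> I.

Definition EQB (At : Type) (G : set (formula At)) : set (ht_interp At) :=
  [set I | [/\ is_total I, belief_model G I &
               ~ exists I', belief_model G I' /\ ht_lt I' I]].

Definition equilibrium_world_view (At : Type) (G : set (formula At))
    (W : set (set At)) : Prop :=
  W !=set0 /\ W = [set T | EQB G (HT (total_view W) T T)].

(* Main.v *)
Require Import Defs.
From mathcomp Require Import all_boot.
From mathcomp Require Import boolp classical_sets.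

(** If an unfounded set [U] witnesses that the equilibrium world view [W] is
    unfounded, weaken [W] by replacing each total pair [<I,I>] whose [I] occurs
    in [U] with the pairs [<I \ X, I>] for [<X,I>] in [U].  A rule whose
    body survives at [<I \ X, I>] meets conditions (1), (2) and (4) of
    unfoundedness, so it either has no head atom in [X] or violates (3); in both cases some head atom lies in [I \ X].
    The weakened view is therefore a belief model strictly below an equilibrium
    one. *)

Set Implicit Arguments.
Unset Strict Implicit.
Unset Printing Implicit Defensive.

Local Open Scope classical_set_scope.

Lemma there_view_total (At : Type) (W : set (set At)) :
  there_view (total_view W) = W.
Proof.
apply/seteqP; split=> [T [_ [S WS <-] <-] //|T WT].
by exists (T, T) => //; exists T.
Qed.

Lemma ht_sat_total (At : Type) (W : set (set At)) (T : set At) (f : formula At) :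
  ht_sat (total_view W) T T f <-> sat W T f.
Proof.
elim: f T => [|a|f IHf g IHg|f IHf g IHg|f IHf g IHg|f IHf] T //=.
- by rewrite IHf IHg.
- by rewrite IHf IHg.
- by rewrite there_view_total IHf IHg; split=> [[]|].
- split=> [fL J WJ|fL Hi Ti [J WJ [<- <-]]]; last exact/IHf/fL.
  by apply/IHf/fL; exists J.
Qed.

(** Persistence: the semantics of an implication already contains its there-world half, and each
    world that [Lop] ranges over in [there_view V] comes from a pair of [V]. *)
Lemma ht_sat_there (At : Type) (V : set (set At * set At)) (H T : set At)
    (f : formula At) :
  (forall Hi Ti, V (Hi, Ti) -> Hi `<=` Ti) -> H `<=` T ->
  ht_sat V H T f -> sat (there_view V) T f.
Proof.
move=> VS; elim: f H T => [|a|f IHf g IHg|f IHf g IHg|f IHf g IHg|f IHf] H T HT //=.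
- exact: HT.
- by move=> [/(IHf _ _ HT) ? /(IHg _ _ HT)].
- by move=> [/(IHf _ _ HT)|/(IHg _ _ HT)]; [left|right].
- by rewrite !ht_sat_total => -[].
- by move=> fL _ [[Hi Ti] VHT <-]; apply: IHf (VS _ _ VHT) (fL _ _ VHT).
Qed.

Lemma ht_sat_head (At : Type) (V : set (set At * set At)) (H T : set At)
    (r : rule At) :
  ht_sat V H T (head_formula r) <-> Head r `&` H !=set0.
Proof.
rewrite /head_formula /Head; elim: (head_atoms r) => [|a s IHs] /=.
  by split=> [//|[x []]].
rewrite IHs; split=> [[Ha|[x [sx Hx]]]|[x [[->|sx] Hx]]].
- by exists a; split=> //; left.
- by exists x; split=> //; right.
- by left.
- by right; exists x.
Qed.

Lemma ht_sat_body_lit (At : Type) (V : set (set At * set At)) (H T : set At)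
    (r : rule At) (l : literal At) :
  ht_sat V H T (body_formula r) -> List.In l (body_lits r) ->
  ht_sat V H T (lit_formula l).
Proof.
rewrite /body_formula; elim: (body_lits r) => [//|m s IHs] /= [satm sats].
by case=> [<- //|]; apply: IHs.
Qed.

Definition weakened_view (At : Type) (W : set (set At))
    (U : set (set At * set At)) : set (set At * set At) :=
  [set (p.2 `\` p.1, p.2) | p in U] `|`
  [set (I, I) | I in W `&` [set I | forall X, ~ U (X, I)]].

Section WeakenedView.

Variables (At : Type) (W : set (set At)) (U : set (set At * set At)).
Hypothesis UW : forall X I, U (X, I) -> W I.

Lemma weakened_view_sub H T : weakened_view W U (H, T) -> H `<=` T.
Proof. by case=> [[[X I] _ [<- <-]] x []|[I _ [<- <-]]]. Qed.

(** Since weakening only shrinks here-components, the classical half of every implication is still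
    evaluated in [W]. *)
Lemma there_weakened_view : there_view (weakened_view W U) = W.
Proof.
apply/seteqP; split=> [T [_ [[[X I] UXI <-]|[I [WI _] <-]] <-]|T WT] //=.
  exact: UW UXI.
have [[X UXT]|/forallNP nU] := pselect (exists X, U (X, T)).
  by exists (T `\` X, T) => //; left; exists (X, T).
by exists (T, T) => //; right; exists T.
Qed.

Lemma weakened_view_le H T : H `<=` T ->
  ht_le (HT (weakened_view W U) H T) (HT (total_view W) T T).
Proof.
move=> HT_; split=> //= [Hi Ti [J WJ [<- <-]]|Hi Ti VHT].
  have : there_view (weakened_view W U) J by rewrite there_weakened_view.
  move=> [[H' J'] VH /= JE]; subst J'; exists H'; split=> //.
  exact: weakened_view_sub VH.
exists Ti; split; last exact: weakened_view_sub VHT.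
by exists Ti => //; rewrite -there_weakened_view; exists (Hi, Ti).
Qed.

Lemma weakened_view_rule (Pi : set (rule At)) (r : rule At) H T :
  unfounded_set Pi W U -> Pi r -> (forall I, W I -> sat W I (rule_formula r)) ->
  weakened_view W U (H, T) -> ht_sat (weakened_view W U) H T (rule_formula r).
Proof.
move=> [_ unfU] Pir modW VHT.
have WT : W T by rewrite -there_weakened_view; exists (H, T).
have headT : sat W T (body_formula r) -> Head r `&` T !=set0.
  by move=> /(modW T WT)/ht_sat_total/ht_sat_head.
split; last by rewrite there_weakened_view !ht_sat_total; apply: modW.
move=> satB; apply/ht_sat_head.
have := satB; move=> /(ht_sat_there weakened_view_sub (weakened_view_sub VHT)).
rewrite there_weakened_view => clB.
(* At an untouched total pair the classical head already suffices. *)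
case: VHT => [[[X I] UXI [/= HE TE]]|[I _ [HE TE]]]; last first.
  by rewrite -HE TE; exact: headT.
subst H T; have [HX0|HX0] := pselect (Head r `&` X !=set0); last first.
  have [a [ha Ia]] := headT clB.
  by exists a; split=> //; split=> // Xa; apply: HX0; exists a.
(* Condition (1) is [clB]. For (2), a positive body atom holds at [I \ X], hence lies outside [X].
   Condition (3) restates [noH]. *)
apply: contrapT => noH; apply: (unfU _ _ UXI); exists r; split=> //; split=> //.
- rewrite -subset0 => a [/(ht_sat_body_lit satB) /= [_ nXa] Xa]; exact: nXa.
- by rewrite -subset0 => a [[ha nXa] Ia]; apply: noH; exists a.
(* Condition (4): a believed atom holds at every weakened pair [(I' \ X', I')], so no [X'] occurring
   in [U] contains it. *)
- rewrite -subset0 => a [/(ht_sat_body_lit satB) /= La [[X' I'] UXI' /= X'a]].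
  have : weakened_view W U (I' `\` X', I') by left; exists (X', I').
  by move=> /La[].
Qed.

End WeakenedView.

Theorem theorem2 (At : Type) (Pi : set (rule At)) (W : set (set At)) :
  equilibrium_world_view (program_theory Pi) W -> founded Pi W.
Proof.
move=> [_ WE] [U [unfU UWX]].
have UW X I : U (X, I) -> W I by move=> /UWX[].
have [[[X0 I0] U0] _] := unfU; have [WI0 [a [X0a I0a]]] := UWX _ _ U0.
have : [set T | EQB (program_theory Pi) (HT (total_view W) T T)] I0 by rewrite -WE.
move=> [_ [_ modW] minW]; apply: minW.
have V0 : weakened_view W U (I0 `\` X0, I0) by left; exists (X0, I0).
(* The designated world is itself a pair of the weakened view, so [weakened_view_rule] covers it
   too. Strictness comes from [a], which lies in [I0] but not in [I0 \ X0]. *)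
exists (HT (weakened_view W U) (I0 `\` X0) I0); split; last first.
  split; first by apply: weakened_view_le => // x [].
  by move=> [_ HE]; move: I0a; rewrite -{1}HE => -[].
split.
  split=> /=; last by move=> x [].
  by split; [exists (I0 `\` X0, I0)|exact: weakened_view_sub].
move=> f [r Pir <-] Hi Ti /= Vi.
apply: (weakened_view_rule UW unfU Pir).
  move=> I WI; apply/ht_sat_total; apply: modW; first by exists r.
  by left; exists I.
by case: Vi => // -[-> ->].
Qed.
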